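(* Let $R$ be an integral domain which is not a field, with quotient field $L$. Let $SD(R)$ be the set of nonzero strongly divisorial ideals of $R$, let $O_t(R)$ be the set of $t$-linked overrings of $R$, and let $\phi_R: SD(R)\to O_t(R)\setminus\{L\}$ be the (injective) map $I\mapsto I^{-1}=(I:I)$. Then: 1) $\phi_R$ is surjective if and only if each $t$-linked overring $T\neq L$ of $R$ is a fractional $v$-ideal of $R$. 2) If $\phi_R$ is surjective, then: (i) $R$ is a conducive domain; (ii) every nonzero nonmaximal prime ideal of $R$ is strong; (iii) if $R$ is not local, then no maximal ideal of $R$ is divisorial, that is, $M^{-1}=R$ for each maximal ideal $M$ of $R$.
   Context: An overring of $R$ is a ring $T$ with $R\subseteq T\subseteq L$. For a nonzero fractional ideal $I$ of $R$, $I^{-1}=(R:I)=\{x\in L: xI\subseteq R\}$, $I_v=(I^{-1})^{-1}$, and $(I:I)=\{x\in L: xI\subseteq I\}$. $I$ is a (fractional) $v$-ideal, or divisorial, if $I=I_v$. An overring $T$ is $t$-linked over $R$ if, for each finitely generated ideal $I$ of $R$, $I^{-1}=R$ implies $(T:IT)=\{x\in L: xIT\subseteq T\}=T$. A nonzero ideal $I$ of $R$ is strong if $I=II^{-1}$, and strongly divisorial if $I=II^{-1}=I_v$ (the ideal $R$ itself is strongly divisorial). If $I$ is strongly divisorial, then $I^{-1}=(I:I)$ is a $t$-linked overring of $R$ different from $L$, so $\phi_R$ is well defined. $R$ is conducive if $(R:T)=\{x\in L: xT\subseteq R\}\neq(0)$ for each overring $T$ of $R$ with $T\neq L$. A local domain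 is a domain with exactly one maximal ideal (not assumed Noetherian). *)

(* Defs.v *)
From HB Require Import structures.
From mathcomp Require Import all_boot all_algebra all_classical.

Set Implicit Arguments.
Unset Strict Implicit.
Unset Printing Implicit Defensive.

Import GRing.Theory.
Local Open Scope classical_set_scope.
Local Open Scope ring_scope.

(* The quotient field L of R is {fraction R}, and R is identified with its
   image in L: ideals, fractional ideals and overrings of R are all subsets of
   L. *)

Notation "x %:F" := (@FracField.tofrac _ x) : ring_scope.

Definition not_field (R : idomainType) : Prop :=
  ~ (forall x : R, x != 0 -> x \is a GRing.unit).

Definition base_ring (R : idomainType) : set {fraction R} :=
  range (fun a : R => a%:F).
Arguments base_ring R : clear implicits.

Definition submodule (R : idomainType) (I : set {fraction R}) : Prop :=
  [/\ I 0,
      forall x y, I x -> I y -> I (x + y) &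
      forall (a : R) x, I x -> I (a%:F * x)].

Definition nonzero (R : idomainType) (I : set {fraction R}) : Prop :=
  exists2 x, I x & x != 0.

Definition fractional_ideal (R : idomainType) (I : set {fraction R}) : Prop :=
  submodule I /\
  exists2 d : R, d != 0 & forall x, I x -> base_ring R (d%:F * x).

Definition ideal (R : idomainType) (I : set {fraction R}) : Prop :=
  submodule I /\ I `<=` base_ring R.

Definition fg_ideal (R : idomainType) (I : set {fraction R}) : Prop :=
  exists (n : nat) (g : 'I_n -> R),
    I = [set x | exists c : 'I_n -> R, x = (\sum_i c i * g i)%:F].

(* (A : B), taken in L *)
Definition colon (R : idomainType) (A B : set {fraction R}) :
  set {fraction R} := [set x | forall y, B y -> A (x * y)].

Definition mul (R : idomainType) (A B : set {fraction R}) :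
  set {fraction R} :=
  [set x | exists (n : nat) (a b : 'I_n -> {fraction R}),
    [/\ forall i, A (a i), forall i, B (b i) & x = \sum_i a i * b i]].

Definition inverse (R : idomainType) (I : set {fraction R}) :
  set {fraction R} := colon (base_ring R) I.

Definition v_closure (R : idomainType) (I : set {fraction R}) :
  set {fraction R} := inverse (inverse I).

Definition fractional_v_ideal (R : idomainType) (I : set {fraction R}) :
  Prop := [/\ fractional_ideal I, nonzero I & I = v_closure I].

Definition overring (R : idomainType) (T : set {fraction R}) : Prop :=
  subring_closed (mem T) /\ base_ring R `<=` T.

Definition t_linked (R : idomainType) (T : set {fraction R}) : Prop :=
  forall I : set {fraction R}, fg_ideal I ->
    inverse I = base_ring R -> colon T (mul I T) = T.

Definition strong (R : idomainType) (I : set {fraction R}) : Prop :=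
  [/\ ideal I, nonzero I & I = mul I (inverse I)].

Definition strongly_divisorial (R : idomainType) (I : set {fraction R}) :
  Prop := strong I /\ I = v_closure I.

Definition SD (R : idomainType) : set (set {fraction R}) :=
  [set I | strongly_divisorial I].
Arguments SD R : clear implicits.

Definition Ot (R : idomainType) : set (set {fraction R}) :=
  [set T | overring T /\ t_linked T].
Arguments Ot R : clear implicits.

Definition phi (R : idomainType) : set {fraction R} -> set {fraction R} :=
  fun I => inverse I.
Arguments phi R I : clear implicits.

Definition conducive (R : idomainType) : Prop :=
  forall T : set {fraction R}, overring T -> T <> setT ->
    colon (base_ring R) T <> [set 0].

Definition prime_ideal (R : idomainType) (P : set {fraction R}) : Prop :=
  [/\ ideal P, ~ P 1 &
      forall a b : R, P (a * b)%:F -> P a%:F \/ P b%:F].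

Definition maximal_ideal (R : idomainType) (M : set {fraction R}) : Prop :=
  [/\ ideal M, ~ M 1 &
      forall J : set {fraction R}, ideal J -> ~ J 1 -> M `<=` J -> J = M].

Definition local_domain (R : idomainType) : Prop :=
  exists! M : set {fraction R}, maximal_ideal M.

(* phi is a well-defined injective map from SD R to Ot R minus L, and
   phi R I = (I : I). *)

Lemma mul_mem (R : idomainType) (A B : set {fraction R}) x y :
  A x -> B y -> mul A B (x * y).
Proof.
by move=> Ax By; exists 1%N, (fun=> x), (fun=> y); split=> //; rewrite big_ord1.
Qed.

Lemma base_ringM (R : idomainType) (x y : {fraction R}) :
  base_ring R x -> base_ring R y -> base_ring R (x * y).
Proof. by move=> [a _ <-] [b _ <-]; exists (a * b); rewrite ?rmorphM. Qed.

Lemma phi_colon (R : idomainType) (I : set {fraction R}) :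
  SD R I -> phi R I = colon I I.
Proof.
move=> [[[Isub IR] _ Istr] _]; apply/seteqP; split=> x Hx y Iy.
  by rewrite Istr mulrC; exact: mul_mem.
by apply: IR; exact: Hx.
Qed.

Lemma phi_inj (R : idomainType) : set_inj (SD R) (phi R).
Proof.
move=> I J /set_mem [_ Iv] /set_mem [_ Jv]; rewrite /phi => eqIJ.
by rewrite Iv Jv /v_closure eqIJ.
Qed.

Lemma phi_fun (R : idomainType) :
  not_field R -> set_fun (SD R) (Ot R `\ setT) (phi R).
Proof.
move=> nF I SDI; have phiE := phi_colon SDI.
case: (SDI) => [[[[I0 Iadd Iscal] IR] [z Iz z0] _] _].
have R_phi : base_ring R `<=` phi R I.
  by move=> _ [a _ <-]; rewrite phiE => y Iy; exact: Iscal.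
split; last first.
  move=> phiT; apply: nF => x x0.
  have [a _ az] := IR _ Iz.
  have : phi R I (x%:F^-1 * z^-1) by rewrite phiT.
  move=> /(_ z Iz); rewrite mulfVK // => -[b _ bx].
  have xb : x * b = 1.
    apply/eqP; rewrite -tofrac_eq rmorphM rmorph1 /= bx divff //.
    by rewrite tofrac_eq0.
  by apply/unitrPr; exists b.
split; first split=> //.
  split.
  - by apply: mem_set; apply: R_phi; exists 1; rewrite ?rmorph1.
  - move=> x y /set_mem Hx /set_mem Hy; apply: mem_set; rewrite phiE in Hx Hy *.
    move=> w Iw; rewrite mulrBl; apply: Iadd; first exact: Hx.
    have := Iscal (-1) _ (Hy w Iw); by rewrite rmorphN rmorph1 mulN1r.
  - move=> x y /set_mem Hx /set_mem Hy; apply: mem_set; rewrite phiE in Hx Hy *.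
    by move=> w Iw; rewrite -mulrA; apply: Hx; exact: Hy.
move=> J [n [g Jg]] JinvR; apply/seteqP; split=> x Hx; last first.
  have JR : J `<=` base_ring R.
    by rewrite Jg => _ [c ->]; exists (\sum_i c i * g i).
  move=> _ [m [a [b [Ja Tb ->]]]]; rewrite phiE in Hx Tb * => w Iw.
  rewrite mulr_sumr mulr_suml; elim/big_ind: _ => // i _.
  have [d _ <-] := JR _ (Ja i).
  rewrite -mulrA; apply: Hx; rewrite -mulrA; apply: Iscal; exact: Tb.
move=> w Iw; rewrite -JinvR => y Jy.
have T1 : phi R I 1 by apply: R_phi; exists 1; rewrite ?rmorph1.
have := Hx _ (mul_mem Jy T1); rewrite mulr1 => /(_ w Iw).
by rewrite mulrAC.
Qed.

(* Main.v *)
(* If [P] is a prime containing no finitely generated [I] with [I^-1 = R], then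
   every overring of [R_P] is t-linked. When phi is onto, such overrings, other
   than [L], are v-ideals, and everything follows from two instances.

   Conduciveness: by Zorn such a nonzero [P] exists, and [R_P] is contained in
   a valuation ring [V <> L]; then [(R : V) <> 0], which forces
   [(R : T) <> 0] for every overring [T <> L].

   Strong primes and maximal ideals: if [P^-1 <> R] and [R_P <> R], put
   [R_P = J^-1] with [J] strongly divisorial. Then [J] is contained in [P], so
   [P^-1 J] is contained in [J] and [P^-1] in [(J : J) = R_P]. Hence
   [P P^-1] is contained in [P R_P] and in [R], that is, in [P]. If [P] is
   moreover maximal, an element [z] of [P^-1] has a conductor [{r | r z in R}]
   containing [P] and some [s] outside [P], so [z] is in [R]: a contradiction. *)

Require Import Defs.
From HB Require Import structures.
From mathcomp Require Import all_boot all_algebra all_classical.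
From mathcomp Require Import ring.

Set Implicit Arguments.
Unset Strict Implicit.
Unset Printing Implicit Defensive.

Import GRing.Theory.
Local Open Scope classical_set_scope.
Local Open Scope ring_scope.

(** * Zorn's lemma for nonempty chains of sets *)

(** The empty chain has empty union, which may fail [P]; so [Zorn_bigcup] is applied to [P] weakened
    to admit the empty set. If the maximal set is empty, it must equal [A0], so it satisfies [P]
    anyway. *)
Lemma Zorn_nonempty_chain (T : Type) (P : set (set T)) (A0 : set T) :
  P A0 ->
  (forall F : set (set T), F !=set0 -> F `<=` P -> total_on F subset ->
     P (\bigcup_(X in F) X)) ->
  exists2 A, P A & forall B, P B -> A `<=` B -> B = A.
Proof.
move=> PA0 chainP; pose Q (A : set T) := A = set0 \/ P A.
have [F FQ Ftot|A [QA Amax]] := @Zorn_bigcup T Q.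
  have [[X [FX PX]]|noP] := pselect (exists X, F X /\ P X); last first.
    left; apply/seteqP; split=> // x [X FX Xx].
    have [X0|PX] := FQ _ FX; first by rewrite X0 in Xx.
    by case: noP; exists X.
  right.
  have -> : \bigcup_(X in F) X = \bigcup_(X in F `&` P) X.
    apply/seteqP; split=> x [Y FY Yx]; last by exists Y => //; case: FY.
    exists Y => //; split=> //.
    by have [Y0|//] := FQ _ FY; rewrite Y0 in Yx.
  apply: chainP; first by exists X.
    by move=> Y [].
  by move=> Y Z [FY _] [FZ _]; exact: Ftot.
have PA : P A.
  have [A_0|//] := QA; have [<-//|A0n] := pselect (A0 = A).
  case: (Amax A0); last by right.
  split; first by rewrite A_0.
  by move=> A0A; apply: A0n; apply/seteqP; split=> //; rewrite A_0.
exists A => // B PB AB; apply: contrapT => BA; apply: (Amax B); last by right.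
by split=> // BsubA; apply: BA; apply/seteqP.
Qed.

(** * The base ring and its overrings inside the quotient field *)

Section FractionSubsets.
Variable R : idomainType.
Implicit Types (A B I J P M T V : set {fraction R}) (x y z : {fraction R}).

Lemma overringP T : overring T <->
  [/\ base_ring R `<=` T, forall x y, T x -> T y -> T (x - y) &
      forall x y, T x -> T y -> T (x * y)].
Proof.
split=> [[[_ TB TM] RT]|[RT TB TM]].
  split=> // x y Tx Ty; apply: set_mem; [apply: TB|apply: TM]; exact: mem_set.
split=> //; split=> [|x y /set_mem Tx /set_mem Ty|x y /set_mem Tx /set_mem Ty].
- by apply: mem_set; apply: RT; exists 1; rewrite ?rmorph1.
- by apply: mem_set; exact: TB.
- by apply: mem_set; exact: TM.
Qed.

Lemma base_ringF (a : R) : base_ring R a%:F.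
Proof. by exists a. Qed.
#[local] Hint Resolve base_ringF : core.

Lemma base_ring1 : base_ring R 1.
Proof. by exists 1; rewrite ?rmorph1. Qed.

Lemma base_ring0 : base_ring R 0.
Proof. by exists 0; rewrite ?rmorph0. Qed.

Lemma base_ringB x y : base_ring R x -> base_ring R y -> base_ring R (x - y).
Proof. by move=> [a _ <-] [b _ <-]; exists (a - b); rewrite ?rmorphB. Qed.

Lemma base_ringD x y : base_ring R x -> base_ring R y -> base_ring R (x + y).
Proof. by move=> [a _ <-] [b _ <-]; exists (a + b); rewrite ?rmorphD. Qed.

Lemma base_ring_sum n (f : 'I_n -> {fraction R}) :
  (forall i, base_ring R (f i)) -> base_ring R (\sum_i f i).
Proof.
move=> fR; elim/big_ind: _ => //; [exact: base_ring0 | exact: base_ringD].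
Qed.

Section Overring.
Variables (T : set {fraction R}) (Tring : overring T).

Lemma overring1 : T 1.
Proof. by case/overringP: Tring => RT _ _; exact: RT base_ring1. Qed.

Lemma overring0 : T 0.
Proof. by case/overringP: Tring => RT _ _; exact: RT base_ring0. Qed.

Lemma overringB x y : T x -> T y -> T (x - y).
Proof. by case/overringP: Tring => _ + _; exact. Qed.

Lemma overringM x y : T x -> T y -> T (x * y).
Proof. by case/overringP: Tring => _ _; exact. Qed.

Lemma overringD x y : T x -> T y -> T (x + y).
Proof.
move=> Tx Ty; rewrite -[y]opprK; apply: overringB => //.
by rewrite -sub0r; apply: overringB => //; exact: overring0.
Qed.

Lemma overringX x n : T x -> T (x ^+ n).
Proof.
move=> Tx; elim: n => [|n IHn]; rewrite ?expr0 ?exprS; first exact: overring1.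
exact: overringM.
Qed.

Lemma overring_sum n (f : 'I_n -> {fraction R}) :
  (forall i, T (f i)) -> T (\sum_i f i).
Proof.
move=> fT; elim/big_ind: _ => //; [exact: overring0 | exact: overringD].
Qed.

End Overring.

Lemma bigcup_overring (F : set (set {fraction R})) :
  F !=set0 -> F `<=` @overring R -> total_on F subset ->
  overring (\bigcup_(X in F) X).
Proof.
move=> [A FA] Fring Ftot.
have FF x y : (\bigcup_(X in F) X) x -> (\bigcup_(X in F) X) y ->
    exists X, [/\ F X, X x & X y].
  move=> [X FX Xx] [Y FY Yy].
  by have [XY|YX] := Ftot _ _ FX FY; [exists Y|exists X]; split=> //; auto.
apply/overringP; split=> [x Rx|x y Ux Uy|x y Ux Uy].
- by exists A => //; case/overringP: (Fring _ FA) => RA _ _; exact: RA.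
- have [X [FX Xx Xy]] := FF _ _ Ux Uy.
  by exists X => //; exact: (overringB (Fring _ FX)).
- have [X [FX Xx Xy]] := FF _ _ Ux Uy.
  by exists X => //; exact: (overringM (Fring _ FX)).
Qed.

(** * Polynomials over an overring and simple extensions [T[x]] *)

Definition poly_over T (p : {poly {fraction R}}) := forall i, T p`_i.

Definition adjoin T x : set {fraction R} :=
  [set y | exists2 p, poly_over T p & y = p.[x]].

Lemma poly_overM T p q : overring T ->
  poly_over T p -> poly_over T q -> poly_over T (p * q).
Proof.
move=> Tring Tp Tq i; rewrite coefM.
by apply: overring_sum => // j; exact: overringM.
Qed.

Lemma poly_overD T p q : overring T ->
  poly_over T p -> poly_over T q -> poly_over T (p + q).
Proof. by move=> Tring Tp Tq i; rewrite coefD; exact: overringD. Qed.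

Lemma poly_over_poly T n (c : nat -> {fraction R}) : overring T ->
  (forall i, (i < n)%N -> T (c i)) -> poly_over T (\poly_(i < n) c i).
Proof.
move=> Tring Tc i; rewrite coef_poly; case: ifP => [/Tc//|_].
exact: overring0.
Qed.

Lemma poly_overXn T n : overring T -> poly_over T 'X^n.
Proof.
move=> Tring i; rewrite coefXn.
by case: (i == n); [exact: overring1|exact: overring0].
Qed.

Lemma sub_adjoin T x : overring T -> T `<=` adjoin T x.
Proof.
move=> Tring y Ty; exists y%:P; last by rewrite hornerC.
by move=> i; rewrite coefC; case: ifP => // _; exact: overring0.
Qed.

Lemma mem_adjoin T x : overring T -> adjoin T x x.
Proof.
by move=> Tring; exists 'X; [exact: (@poly_overXn T 1)|rewrite hornerX].
Qed.

Lemma overring_adjoin T x : overring T -> overring (adjoin T x).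
Proof.
move=> Tring; apply/overringP; split=> [y Ry|_ _ [p Tp ->] [q Tq ->]|].
- by apply: sub_adjoin => //; case/overringP: Tring => + _ _; exact.
- exists (p - q); last by rewrite hornerD hornerN.
  by move=> i; rewrite coefB; exact: overringB.
- move=> _ _ [p Tp ->] [q Tq ->].
  by exists (p * q); [exact: poly_overM|rewrite hornerM].
Qed.

(** * Valuation overrings and conduciveness *)

Section MaximalOmitting.
Variables (V : set {fraction R}) (a : {fraction R}).
Hypotheses (Vring : overring V) (Va : V a) (a0 : a != 0) (nVa : ~ V a^-1).
Hypothesis Vmax : forall T, overring T -> V `<=` T -> ~ T a^-1 -> T = V.

Lemma maximal_omitting_adjoin x : ~ V x -> adjoin V x a^-1.
Proof.
move=> nVx; apply: contrapT => nT; apply: nVx.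
rewrite -(Vmax (overring_adjoin x Vring) (sub_adjoin x Vring) nT).
exact: mem_adjoin.
Qed.

Lemma sub1_mul_neq0 b : V b -> 1 - a * b != 0.
Proof.
move=> Vb; apply/eqP => u0; apply: nVa.
have -> // : a^-1 = b.
by apply: (mulfI a0); rewrite mulfV //; apply/eqP; rewrite -subr_eq0 u0.
Qed.

Lemma sub1_mulX b n : V b -> exists2 c, V c & (1 - a * b) ^+ n = 1 - a * c.
Proof.
move=> Vb; elim: n => [|n [c Vc IHn]].
  by exists 0; [exact: overring0|rewrite mulr0 subr0 expr0].
exists (b + c - a * b * c); last by rewrite exprS IHn; ring.
by apply: overringB => //; [apply: overringD|do 2?apply: overringM].
Qed.

(* [a] lies in the Jacobson radical of [V]: inverting [1 - a b] cannot create
   [a^-1], because [a^-1 (1 - a b)^n] and [a^-1] agree modulo [V]. *)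
Lemma maximal_omitting_unit b : V b -> V (1 - a * b)^-1.
Proof.
move=> Vb; apply: contrapT => /maximal_omitting_adjoin[p Vp ap].
have u0 := sub1_mul_neq0 Vb; set u := 1 - a * b in ap u0 *.
have [c Vc uc] := sub1_mulX (size p) Vb; rewrite -/u in uc.
apply: nVa; have -> : a^-1 = a^-1 * u ^+ size p + c.
  by rewrite uc mulrBr mulr1 mulKf // subrK.
(* Powers of [u^-1] in [p.[u^-1]] have exponent below [size p], so [u ^+ size p] clears every
   denominator. *)
apply: overringD => //; rewrite {1}ap horner_coef mulr_suml.
apply: overring_sum => // i; rewrite -mulrA; apply: overringM => //.
rewrite exprVn mulrC -expfB_cond ?(negPf u0) ?add0n; last exact: ltnW.
apply: overringX => //; apply: overringB => //; first exact: overring1.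
exact: overringM.
Qed.

(* A relation of degree [m] for [x^-1] makes [x] integral of degree [m] over
   [V]; it then lowers the degree of any relation for [x] of degree >= [m]. *)
Lemma maximal_omitting_inv_integral q x : x != 0 ->
  poly_over V q -> a^-1 = q.[x^-1] ->
  exists h, [/\ poly_over V h, (size h < size q)%N & x ^+ (size q).-1 = h.[x]].
Proof.
move=> x0 Vq aq; have q0 : q != 0.
  apply/eqP => q0; move/eqP: aq; rewrite q0 horner0 invr_eq0.
  by rewrite (negPf a0).
have := polySpred q0; set m := (size q).-1 => sq.
set u := 1 - a * q`_0; have u0 : u != 0 by exact: sub1_mul_neq0.
(* Multiply [a * q.[x^-1] = 1] by [x ^+ m], move the constant term of [q] to the other side, and
   divide by [u], a unit of [V]. *)
pose h := \poly_(j < m) (a * u^-1 * q`_(m - j)).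
exists h; split.
- apply: poly_over_poly => // j _; do 2?apply: overringM => //.
  exact: maximal_omitting_unit.
- by rewrite sq ltnS size_poly.
- have E : a * q.[x^-1] = 1 by rewrite -aq mulfV.
  have uE : u = a * \sum_(i < m) q`_i.+1 * x^-1 ^+ i.+1.
    rewrite /u -{1}E horner_coef sq big_ord_recl expr0 mulr1 mulrDr addrAC.
    by rewrite subrr add0r.
  have hE : u * h.[x] = a * \sum_(j < m) q`_(m - j) * x ^+ j.
    rewrite horner_poly !mulr_sumr; apply: eq_bigr => j _.
    by rewrite -!mulrA [LHS]mulrCA mulVKf.
  apply: (mulfI u0); rewrite hE {1}uE -mulrA mulr_suml; congr (a * _).
  rewrite (reindex_inj rev_ord_inj) /=; apply: eq_bigr => i _.
  rewrite subnSK // -mulrA; congr (_ * _).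
  by rewrite -[in x ^+ m](subnK (ltnW (ltn_ord i))) exprD exprVn mulKf ?expf_neq0.
Qed.

(** Descent on [size p + size q]: the monic relation of the previous lemma shortens the longer of
    the two polynomials. *)
Lemma maximal_omitting_no_relations N x (p q : {poly {fraction R}}) :
  (size p + size q < N)%N ->
  x != 0 -> poly_over V p -> poly_over V q ->
  a^-1 = p.[x] -> a^-1 = q.[x^-1] -> False.
Proof.
elim: N x p q => // N IHN x p q; rewrite ltnS => leN x0 Vp Vq ap aq.
(* Exchanging [x] and [x^-1] swaps the roles of [p] and [q]. *)
wlog leqp : x p q leN x0 Vp Vq ap aq / (size q <= size p)%N.
  move=> H; have [leqp|/ltnW leqp] := leqP (size q) (size p).
    exact: (H x p q).
  by have := H x^-1 q p; rewrite invr_eq0 invrK addnC; exact.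
have [h [Vh sh xm]] := maximal_omitting_inv_integral x0 Vq aq.
have [p0|] := posnP (size p); first by rewrite p0 in leqp; case: (size q) leqp sh.
move=> p_gt0; have sp := prednK p_gt0; set n := (size p).-1 in sp.
set m := (size q).-1 in xm.
have sq : m.+1 = size q by rewrite prednK // (leq_ltn_trans _ sh).
have lemn : (m <= n)%N by rewrite -ltnS sq sp.
(* In the leading term, [x ^+ n] becomes [x ^+ (n - m) * h.[x]]: the value at [x] is kept, and the
   size drops because [size h <= m]. *)
pose p' := \poly_(i < n) p`_i + (p`_n)%:P * ('X^(n - m) * h).
have sp' : (size p' < size p)%N.
  rewrite -sp ltnS (leq_trans (size_polyD _ _)) // geq_max size_poly /=.
  rewrite mul_polyC (leq_trans (size_scale_leq _ _)) //.
  rewrite (leq_trans (size_polyMleq _ _)) // size_polyXn /=.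
  by rewrite -leq_subRL ?leq_subr // subKn // -ltnS sq.
apply: (IHN x p' q) => //.
- by rewrite (leq_trans _ leN) // ltn_add2r.
- apply: poly_overD => //; first exact: poly_over_poly.
  apply: poly_overM => //; last by apply: poly_overM => //; exact: poly_overXn.
  by move=> i; rewrite coefC; case: ifP => // _; exact: overring0.
- rewrite ap /p' hornerD !hornerM hornerC hornerXn horner_poly -xm -exprD.
  rewrite subnK //.
  by rewrite horner_coef -sp big_ord_recr.
Qed.

Lemma maximal_omitting_valuation x : x != 0 -> V x \/ V x^-1.
Proof.
move=> x0; have [|nVx] := pselect (V x); first by left.
have [|nVx1] := pselect (V x^-1); first by right.
have [p Vp ap] := maximal_omitting_adjoin nVx.
have [q Vq aq] := maximal_omitting_adjoin nVx1.
by case: (@maximal_omitting_no_relations (size p + size q).+1 x p q).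
Qed.

End MaximalOmitting.

(** A form of Chevalley's extension theorem: Zorn's lemma gives an overring above [B] maximal for
    omitting [a^-1]. The omission also keeps [V] away from the whole quotient field. *)
Lemma valuation_overring_omitting B a :
  overring B -> B a -> a != 0 -> ~ B a^-1 ->
  exists V, [/\ overring V, B `<=` V, ~ V a^-1 &
                forall x, x != 0 -> V x \/ V x^-1].
Proof.
move=> Bring Ba a0 nBa.
pose Q A := [/\ overring A, B `<=` A & ~ A a^-1].
have [|F F0 FQ Ftot|V [Vring BV nVa] Vmax] := @Zorn_nonempty_chain _ Q B.
- by split=> // x.
- split.
  + by apply: bigcup_overring => // X /FQ[].
  + by case: F0 => X FX x Bx; exists X => //; case: (FQ _ FX) => _ + _; exact.
  + by move=> [X /FQ[_ _ +]]; exact.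
exists V; split=> //; apply: (@maximal_omitting_valuation V a) => //.
  exact: BV.
by move=> T Tring VT nTa; apply: Vmax => //; split=> // x /BV /VT.
Qed.

(* The nonzero multiple found is [d y], where [d V] lies in [R]: if it fails,
   some [t y] with [t] in [T] is outside [V], so that [d / (t y)] is in [R] and
   [d / y] is in [T]. *)
Lemma conducive_of_valuation V d : overring V ->
  (forall x, x != 0 -> V x \/ V x^-1) ->
  d != 0 -> colon (base_ring R) V d -> conducive R.
Proof.
move=> Vring Vval d0 dV T Tring TL colon0; apply: TL.
have RT : base_ring R `<=` T by case/overringP: Tring.
have RV : base_ring R `<=` V by case/overringP: Vring.
have Rd : base_ring R d by have := dV _ (overring1 Vring); rewrite mulr1.
have Tinv y : y != 0 -> T (d / y).
  move=> y0; apply: contrapT => nT.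
  suff : colon (base_ring R) T (d * y).
    by rewrite colon0 => /eqP; rewrite mulf_eq0 (negPf d0) (negPf y0).
  move=> t Tt; rewrite -mulrA.
  have [->|t0] := eqVneq t 0; first by rewrite !mulr0; exact: base_ring0.
  have [||Vty] := Vval (y * t); first by rewrite mulf_neq0.
    exact: dV.
  case: nT; have -> : d / y = d * (y * t)^-1 * t.
    by rewrite invfM -!mulrA mulVf ?mulr1.
  by apply: overringM => //; apply: RT; exact: dV.
apply/seteqP; split=> // x _.
have [->|x0] := eqVneq x 0; first exact: overring0.
(* [Tinv] at [y = d / x] reaches an arbitrary nonzero [x]. *)
have -> : x = d / (d / x) by rewrite invf_div mulrCA divff ?mulr1.
by apply: Tinv; rewrite mulf_neq0 ?invr_eq0.
Qed.

(** * Ideals, and primes containing no finitely generated ideal of trivial inverse *)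

Lemma ideal_sum n (f : 'I_n -> {fraction R}) I : submodule I ->
  (forall i, I (f i)) -> I (\sum_i f i).
Proof. by move=> [I0 ID _] If; elim/big_ind: _. Qed.

Lemma base_ring_sub_inverse I : ideal I -> base_ring R `<=` inverse I.
Proof. by move=> [_ IR] x Rx y /IR; exact: base_ringM. Qed.

Lemma ideal1P I : ideal I -> I 1 -> I = base_ring R.
Proof.
move=> [[_ _ IM] IR] I1; apply/seteqP; split=> // _ [a _ <-].
by rewrite -[a%:F]mulr1; exact: IM.
Qed.

Lemma ideal_base_ring : ideal (base_ring R).
Proof.
split=> //; split; [exact: base_ring0|exact: base_ringD|].
by move=> a x; exact: base_ringM.
Qed.

(* [s] generates an ideal [I] with [I^-1 = R]. *)
Definition inverse_trivial (s : seq R) : Prop :=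
  forall x, (forall g, g \in s -> base_ring R (x * g%:F)) -> base_ring R x.

(* [P] contains no finitely generated ideal [I] with [I^-1 = R]; this holds in
   particular for every proper t-ideal. *)
Definition t_proper P : Prop :=
  forall s, inverse_trivial s -> exists2 g, g \in s & ~ P g%:F.

(** This is [(R : IJ) = ((R : J) : I)]: triviality of [t] puts each [x * f] in [R], then that of [s]
    puts [x] in [R]. *)
Lemma inverse_trivialM s t : inverse_trivial s -> inverse_trivial t ->
  inverse_trivial [seq f * g | f <- s, g <- t].
Proof.
move=> s1 t1 x Hx; apply: s1 => f sf; apply: t1 => g tg.
by rewrite -mulrA -rmorphM; apply: Hx; apply/allpairsP; exists (f, g).
Qed.

(** Inverses reverse inclusions: a sequence in [P] with trivial inverse would force [P^-1] into
    [R]. *)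
Lemma t_proper_inverse P : ideal P -> inverse P <> base_ring R -> t_proper P.
Proof.
move=> Pid PinvR s s1; apply: contrapT => sP; apply: PinvR.
apply/seteqP; split; last exact: base_ring_sub_inverse.
move=> x Px; apply: s1 => g sg; apply: Px.
by apply: contrapT => nPg; apply: sP; exists g.
Qed.

Definition principal (a : {fraction R}) : set {fraction R} :=
  [set x | exists r : R, x = r%:F * a].

Definition adjoin_ideal I a : set {fraction R} :=
  [set x | exists y (r : R), I y /\ x = y + r%:F * a].

Lemma ideal_adjoin I a : ideal I -> base_ring R a -> ideal (adjoin_ideal I a).
Proof.
move=> [[I0 ID IM] IR] Ra; split; first split.
- by exists 0, 0; rewrite rmorph0 mul0r addr0.
- move=> _ _ [y [r [Iy ->]]] [z [s [Iz ->]]].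
  by exists (y + z), (r + s); split; [exact: ID|rewrite rmorphD; ring].
- move=> c _ [y [r [Iy ->]]]; exists (c%:F * y), (c * r).
  by split; [exact: IM|rewrite rmorphM; ring].
- move=> _ [y [r [/IR Ry ->]]]; apply: base_ringD => //.
  exact: base_ringM.
Qed.

Lemma sub_adjoin_ideal I a : I `<=` adjoin_ideal I a.
Proof. by move=> x Ix; exists x, 0; rewrite rmorph0 mul0r addr0. Qed.

Lemma mem_adjoin_ideal I a : ideal I -> adjoin_ideal I a a.
Proof. by move=> [[I0 _ _] _]; exists 0, 1; rewrite rmorph1 mul1r add0r. Qed.

Lemma bigcup_ideal (F : set (set {fraction R})) :
  F !=set0 -> F `<=` @ideal R -> total_on F subset ->
  ideal (\bigcup_(X in F) X).
Proof.
move=> [A FA] Fid Ftot; split; first split.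
- by exists A => //; case: (Fid _ FA) => -[].
- move=> x y [X FX Xx] [Y FY Yy].
  have [XY|YX] := Ftot _ _ FX FY; [exists Y => //|exists X => //].
    by case: (Fid _ FY) => -[_ + _] _; apply=> //; exact: XY.
  by case: (Fid _ FX) => -[_ + _] _; apply=> //; exact: YX.
- move=> a x [X FX Xx]; exists X => //.
  by case: (Fid _ FX) => -[_ _ +] _; exact.
- by move=> x [X FX Xx]; case: (Fid _ FX) => _; exact.
Qed.

(** Makes [t_proper] pass to unions of chains, since it tests only finite sequences. *)
Lemma chain_finite (T : eqType) (F : set (set {fraction R}))
    (f : T -> {fraction R}) (s : seq T) :
  F !=set0 -> total_on F subset ->
  (forall g, g \in s -> (\bigcup_(X in F) X) (f g)) ->
  exists2 X, F X & forall g, g \in s -> X (f g).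
Proof.
move=> [A FA] Ftot; elim: s => [_|g s IHs sF]; first by exists A.
have [h sh|X FX sX] := IHs; first by apply: sF; rewrite inE sh orbT.
have [Y FY Yg] := sF g (mem_head _ _).
have [XY|YX] := Ftot _ _ FX FY.
  by exists Y => // h; rewrite inE => /predU1P[->//|/sX /XY].
by exists X => // h; rewrite inE => /predU1P[->|/sX//]; exact: YX.
Qed.

(** For a nonzero nonunit [a], the ideal [aR] is [t_proper]: a trivial [s] inside it would put
    [a^-1] in [R]. An ideal maximal among the [t_proper] ones containing [a] is prime. *)
Lemma exists_t_proper_prime : not_field R ->
  exists P, [/\ prime_ideal P, nonzero P & t_proper P].
Proof.
move=> nF; have [a a0 nUa] : exists2 a : R, a != 0 & a \isn't a GRing.unit.
  apply: contrapT => H; apply: nF => x x0; apply: contrapT => /negP nUx.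
  by apply: H; exists x.
have aF0 : a%:F != 0 by rewrite tofrac_eq0.
pose Q I := [/\ ideal I, I a%:F & t_proper I].
have [|F F0 FQ Ftot|P [Pid Pa Pt] Pmax] :=
    @Zorn_nonempty_chain _ Q (principal a%:F).
- split; last first.
  + move=> s s1; apply: contrapT => sa; move/negP: nUa; apply.
    have [b _ ba] : base_ring R a%:F^-1.
      apply: s1 => g sg; have [r ->] : principal a%:F g%:F.
        by apply: contrapT => nag; apply: sa; exists g.
      by rewrite mulrC mulfK //; exact: base_ringF.
    apply/unitrPr; exists b; apply/eqP.
    by rewrite -tofrac_eq rmorphM rmorph1 /= ba divff.
  + by exists 1; rewrite rmorph1 mul1r.
  + split; last by move=> _ [r ->]; exact: base_ringM.
    split; first by exists 0; rewrite rmorph0 mul0r.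
      by move=> _ _ [r ->] [s ->]; exists (r + s); rewrite rmorphD mulrDl.
    by move=> c _ [r ->]; exists (c * r); rewrite rmorphM mulrA.
- split.
  + by apply: bigcup_ideal => // X /FQ[].
  + by case: F0 => X FX; exists X => //; case: (FQ _ FX).
  + move=> s s1; apply: contrapT => sF.
    have [g sg|X FX sX] := @chain_finite R F (fun g => g%:F) s F0 Ftot.
      by apply: contrapT => nFg; apply: sF; exists g.
    by have [_ _ /(_ _ s1)[g /sX]] := FQ _ FX.
exists P; split=> //; last by exists a%:F.
split=> //.
  have [|g] := Pt [:: 1].
    by move=> x /(_ 1 (mem_head _ _)); rewrite rmorph1 mulr1.
  by rewrite inE => /eqP ->; rewrite rmorph1.
have extend (x : R) : ~ P x%:F -> exists2 s, inverse_trivial s &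
    forall g, g \in s -> adjoin_ideal P x%:F g%:F.
  move=> nPx; apply: contrapT => H; apply: nPx.
  rewrite -[P](_ : adjoin_ideal P x%:F = P); first exact: mem_adjoin_ideal.
  apply: Pmax; last exact: sub_adjoin_ideal.
  split; [exact: ideal_adjoin (base_ringF _)|exact: sub_adjoin_ideal|].
  move=> s s1; apply: contrapT => sP; apply: H; exists s => // g sg.
  by apply: contrapT => ng; apply: sP; exists g.
(* By maximality [P + xR] and [P + yR] contain trivial sequences [s] and [t]. Their products form a
   trivial sequence inside [P + xyR], hence inside [P]. *)
move=> x y Pxy; apply: contrapT => /not_orP[/extend[s s1 sx] /extend[t t1 ty]].
have [g /allpairsP[[f h] /= [/sx[p [r [Pp fE]]] /ty[q [c [Pq hE]]] ->]]] :=
  Pt _ (inverse_trivialM s1 t1).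
apply; case: Pid => -[_ PD PM] PR.
rewrite rmorphM /= fE hE.
have [q' _ qE] := PR _ Pq.
have -> : (p + r%:F * x%:F) * (q + c%:F * y%:F) =
  q'%:F * p + (c * y)%:F * p + ((r * x)%:F * q + (r * c)%:F * (x * y)%:F).
  by rewrite qE !rmorphM; ring.
by do !apply: (PD); apply: PM.
Qed.

(** * Localization at a prime *)

Definition localization P : set {fraction R} :=
  [set x | exists2 s : R, ~ P s%:F & base_ring R (s%:F * x)].

Section Localization.
Variables (P : set {fraction R}) (Pprime : prime_ideal P).

Lemma prime_notinM (s t : R) : ~ P s%:F -> ~ P t%:F -> ~ P (s * t)%:F.
Proof. by case: Pprime => _ _ Pp nPs nPt /Pp[]. Qed.

Lemma localization_overring : overring (localization P).
Proof.
case: (Pprime) => _ P1 _; apply/overringP; split.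
- by move=> x Rx; exists 1; rewrite rmorph1 ?mul1r.
- move=> x y [s nPs sx] [t nPt ty]; exists (s * t); first exact: prime_notinM.
  have -> : (s * t)%:F * (x - y) = t%:F * (s%:F * x) - s%:F * (t%:F * y).
    by rewrite rmorphM; ring.
  by apply: base_ringB; apply: base_ringM.
- move=> x y [s nPs sx] [t nPt ty]; exists (s * t); first exact: prime_notinM.
  by rewrite rmorphM mulrACA; exact: base_ringM.
Qed.

Lemma localizationV (s : R) : ~ P s%:F -> localization P s%:F^-1.
Proof.
move=> nPs; exists s => //; rewrite divff; first exact: base_ring1.
by apply/eqP => s0; apply: nPs; rewrite s0; case: Pprime => -[[]].
Qed.

(** A denominator [s] of [y] puts [s * (x * y)] in [P], and primality cancels [s]. This is the
    contraction of [P R_P] to [R], on products. *)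
Lemma localization_mul x y : P x -> localization P y ->
  base_ring R (x * y) -> P (x * y).
Proof.
case: Pprime => -[[_ _ PM] _] _ Pp Px [s nPs [t _ tE]] [c _ cE].
have /Pp[] // : P (s * c)%:F by rewrite rmorphM /= cE mulrCA -tE mulrC; exact: PM.
by rewrite cE.
Qed.

Lemma localization_neqT : nonzero P -> localization P <> setT.
Proof.
case: (Pprime) => -[[_ _ PM] PR] _ _ [a Pa a0] PT.
have : localization P a^-1 by rewrite PT.
move=> [s nPs [r _ rE]]; apply: nPs.
have -> : s%:F = r%:F * a by rewrite rE mulfVK.
exact: PM.
Qed.

(** If [I^-1 = R], some generator of [I] lies outside [P] and becomes a unit in [T]. So [IT]
    contains 1, and [(T : IT)] is inside [T]. *)
Lemma t_linked_localization T : t_proper P ->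
  overring T -> localization P `<=` T -> t_linked T.
Proof.
move=> Pt Tring PT I [n [g IE]] IinvR.
have Ig i : I (g i)%:F.
  rewrite IE; exists (fun j => (j == i)%:R); congr (_ %:F).
  rewrite (bigD1 i) //= eqxx mul1r big1 ?addr0 // => j.
  by move=> /negPf ->; rewrite mul0r.
have [|h /mapP[i _ ->] nPg] := Pt (map g (enum 'I_n)).
  move=> x Hx; rewrite -IinvR IE => _ [c ->]; rewrite rmorph_sum mulr_sumr /=.
  apply: base_ring_sum => i; rewrite rmorphM /= mulrCA; apply: base_ringM => //.
  by apply: Hx; rewrite map_f ?mem_enum.
apply/seteqP; split=> x.
  move=> /(_ _ (mul_mem (Ig i) (PT _ (localizationV nPg)))).
  rewrite divff ?mulr1 //; apply/eqP => gi0; apply: nPg; rewrite gi0.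
  by case: Pprime => -[[]].
move=> Tx _ [m [u [v [Iu Tv ->]]]]; rewrite mulr_sumr.
apply: overring_sum => // j; do 2?apply: overringM => //.
have := Iu j; rewrite IE => -[c ->].
by case/overringP: Tring => RT _ _; apply: RT; exact: base_ringF.
Qed.

End Localization.

(** * Strongly divisorial ideals versus divisorial overrings *)

(** Inverting [I = I_v] gives divisoriality; any nonzero element of [I] is a common denominator. *)
Lemma inverse_fractional_v_ideal I : SD R I -> fractional_v_ideal (inverse I).
Proof.
move=> [[Iid [z Iz z0] _] Iv]; split; last by rewrite {1}Iv.
  have [[_ _ IM] IR] := Iid; split; first split.
  - by move=> y Iy; rewrite mul0r; exact: base_ring0.
  - by move=> x y Ix Iy w Iw; rewrite mulrDl; apply: base_ringD; auto.
  - by move=> c x Ix w Iw; rewrite -mulrA; apply: base_ringM => //; exact: Ix.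
  have [d _ dz] := IR _ Iz; exists d; first by rewrite -tofrac_eq0 dz.
  by move=> x Ix; rewrite dz mulrC; exact: Ix.
exists 1; last exact: oner_neq0.
by apply: base_ring_sub_inverse => //; exact: base_ring1.
Qed.

(** The conductor [C = (R : T)] is a [T]-module and [C^-1 = T_v = T], so [C C^-1 = C T = C]. *)
Lemma inverse_overring_SD T : overring T -> fractional_v_ideal T ->
  SD R (inverse T).
Proof.
move=> Tring [[_ [d d0 dT]] _ Tv].
have T1 := overring1 Tring.
have TM x t : inverse T x -> T t -> inverse T (x * t).
  by move=> Tx Tt y Ty; rewrite -mulrA; apply: Tx; exact: overringM.
split; last exact: (congr1 (@inverse R) Tv).
split.
- split; last by move=> x /(_ 1 T1); rewrite mulr1.
  split.
  + by move=> y _; rewrite mul0r; exact: base_ring0.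
  + by move=> x y Tx Ty t Tt; rewrite mulrDl; apply: base_ringD; auto.
  + by move=> c x Tx t Tt; rewrite -mulrA; apply: base_ringM => //; exact: Tx.
- by exists d%:F; rewrite ?tofrac_eq0.
- apply/seteqP; split=> x.
    move=> Tx; rewrite -[x]mulr1; apply: mul_mem => //.
    by move: T1; rewrite {1}Tv.
  move=> [n [a [b [Ta Tb ->]]]] t Tt; rewrite mulr_suml.
  apply: base_ring_sum => i; apply: (TM (a i) (b i)) => //.
  by rewrite Tv; exact: Tb.
Qed.

(** * Consequences of surjectivity for [P^-1] *)

Section Surjective.
Hypothesis phi_surj : set_surj (SD R) (Ot R `\ setT) (phi R).

Lemma surj_inverse T : Ot R T -> T <> setT -> exists2 J, SD R J & inverse J = T.
Proof. by move=> TO TL; case: (phi_surj (conj TO TL)) => J SDJ; exists J. Qed.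

(* With [R_P = J^-1], one has [J = (R : R_P)] and [J] is contained in [P], so
   [P^-1] maps [J] into [R], hence into [J]. *)
Lemma inverse_sub_localization P : prime_ideal P -> nonzero P ->
  inverse P <> base_ring R -> localization P <> base_ring R ->
  inverse P `<=` localization P.
Proof.
move=> Pprime Pn0 PinvR locR; have Pid : ideal P by case: Pprime.
have locring := localization_overring Pprime.
have [||J SDJ JE] := @surj_inverse (localization P).
- split=> //; apply: (t_linked_localization Pprime) => //.
  exact: t_proper_inverse.
- exact: localization_neqT.
have phiJ := phi_colon SDJ; rewrite /phi JE in phiJ.
have [[[[_ _ JM] JR] _ _] Jv] := SDJ.
have locJ x j : localization P x -> J j -> J (x * j) by rewrite phiJ; exact.
(* An element of [J] outside [P] is invertible in [R_P]; since [R_P J] lies in [J], this gives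
   [J = R] and [R_P = R^-1 = R]. *)
have JP : J `<=` P.
  move=> j Jj; have [s _ sE] := JR _ Jj; apply: contrapT => nPj.
  apply: locR; rewrite -JE [J](_ : _ = base_ring R).
    apply/seteqP; split; last exact: base_ring_sub_inverse ideal_base_ring.
    by move=> x /(_ 1 base_ring1); rewrite mulr1.
  apply: ideal1P; first by case: SDJ => -[].
  rewrite -sE in nPj; have := locJ _ _ (localizationV Pprime nPj) Jj.
  rewrite -sE mulVf //; apply/eqP => s0; apply: nPj.
  by rewrite s0; case: Pid => -[].
move=> y Py; rewrite phiJ => j Jj; rewrite Jv /v_closure JE => t Pt.
by rewrite mulrAC -mulrA; apply: Py; apply: JP; exact: locJ.
Qed.

End Surjective.

(** * Maximal ideals, and the case [R_P = R] *)

Lemma maximal_adjoin_1 M (r : R) : maximal_ideal M -> ~ M r%:F ->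
  exists m (c : R), M m /\ 1 = m + c%:F * r%:F.
Proof.
move=> [Mid M1 Mmax] nMr; apply: contrapT => H; apply: nMr.
rewrite -(Mmax (adjoin_ideal M r%:F)); first exact: mem_adjoin_ideal.
- exact: ideal_adjoin (base_ringF _).
- exact: H.
- exact: sub_adjoin_ideal.
Qed.

Lemma maximal_prime M : maximal_ideal M -> prime_ideal M.
Proof.
move=> Mmax; case: (Mmax) => Mid M1 _; split=> // x y Mxy.
have [|nMx] := pselect (M x%:F); first by left.
right; have [m [c [Mm E]]] := maximal_adjoin_1 Mmax nMx.
have -> : y%:F = y%:F * m + c%:F * (x * y)%:F.
  by rewrite -[LHS]mulr1 E rmorphM; ring.
by case: Mid => -[_ MD MM] _; apply: MD; apply: MM.
Qed.

Lemma maximal_nonzero M : not_field R -> maximal_ideal M -> nonzero M.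
Proof.
move=> nF Mmax; apply: contrapT => M0; apply: nF => x x0.
have Mz m : M m -> m = 0.
  by move=> Mm; apply/eqP; apply: contrapT => /negP m0; apply: M0; exists m.
have [|m [c [/Mz ->]]] := @maximal_adjoin_1 M x Mmax.
  by move/Mz/eqP; rewrite tofrac_eq0 (negPf x0).
rewrite add0r -rmorphM /= -(rmorph1 (@tofrac R)) => /eqP; rewrite tofrac_eq.
by move/eqP => cx; apply/unitrPr; exists c; rewrite mulrC.
Qed.

(** When [R_P = R], elements of [R] outside [P] are units. This makes [P] the unique maximal ideal
    in the next two lemmas. *)
Lemma localization_base_ring_unit P I x : prime_ideal P ->
  localization P = base_ring R -> ideal I -> I x -> ~ P x -> I 1.
Proof.
move=> Pprime locR [[_ _ IM] IR] Ix nPx; have [s _ sE] := IR _ Ix.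
rewrite -sE in nPx Ix; have := localizationV Pprime nPx.
rewrite locR => -[r _ rE]; rewrite -[1](@mulVf _ s%:F).
  by rewrite -rE; exact: IM.
by apply/eqP => s0; apply: nPx; rewrite s0; case: Pprime => -[[]].
Qed.

Lemma localization_base_ring_maximal P : prime_ideal P ->
  localization P = base_ring R -> maximal_ideal P.
Proof.
move=> Pprime locR; case: (Pprime) => Pid P1 _; split=> // J Jid J1 PJ.
apply/seteqP; split=> // x Jx; apply: contrapT => nPx; apply: J1.
exact: (localization_base_ring_unit Pprime locR Jid Jx).
Qed.

Lemma localization_base_ring_local P : prime_ideal P ->
  localization P = base_ring R -> local_domain R.
Proof.
move=> Pprime locR; exists P; split.
  exact: localization_base_ring_maximal.
move=> M [Mid M1 Mmax]; case: (Pprime) => Pid P1 _.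
apply: Mmax => // x Mx; apply: contrapT => nPx; apply: M1.
exact: (localization_base_ring_unit Pprime locR Mid Mx).
Qed.

End FractionSubsets.

(** * The equivalence and the three consequences *)

Theorem proposition4p1 (R : idomainType) (R_nf : not_field R) :
  (set_surj (SD R) (Ot R `\ setT) (phi R) <->
     (forall T : set {fraction R},
        Ot R T -> T <> setT -> fractional_v_ideal T)) /\
  (set_surj (SD R) (Ot R `\ setT) (phi R) ->
     [/\ conducive R,
         (forall P : set {fraction R},
            prime_ideal P -> nonzero P -> ~ maximal_ideal P -> strong P) &
         (~ local_domain R ->
            forall M : set {fraction R}, maximal_ideal M ->
              ~ fractional_v_ideal M /\ inverse M = base_ring R)]).
Proof.
have surj_v : set_surj (SD R) (Ot R `\ setT) (phi R) ->
    forall T : set {fraction R}, Ot R T -> T <> setT -> fractional_v_ideal T.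
  move=> phi_surj T TO TL; have [J SDJ <-] := surj_inverse phi_surj TO TL.
  exact: inverse_fractional_v_ideal.
split; first split=> // Tv T [TO TL].
  (* The preimage is the conductor [(R : T)], whose inverse is [T_v = T]. *)
  have [_ _ TE] := Tv _ TO TL; exists (inverse T); last by rewrite [RHS]TE.
  by apply: inverse_overring_SD; [case: TO|exact: Tv].
move=> phi_surj; split.
- have [P [Pprime Pn0 Pt]] := exists_t_proper_prime R_nf.
  have locring := localization_overring Pprime.
  have [x nPx] : exists x, ~ localization P x.
    apply: contrapT => H; apply: (localization_neqT Pprime Pn0).
    by apply/seteqP; split=> // x _; apply: contrapT => nPx; apply: H; exists x.
  have [a Pa a0] := Pn0.
  have locRa : localization P a.
    have [RT _ _] := (overringP _).1 locring; apply: RT.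
    by have [[_ PR] _ _] := Pprime; exact: PR.
  (* Otherwise contraction would put [a * a^-1 = 1] in [P]. *)
  have nlocaV : ~ localization P a^-1.
    move=> locaV; have := localization_mul Pprime Pa locaV.
    by rewrite divff //; case: Pprime => _ P1 _ /(_ (base_ring1 R)).
  have [V [Vring PV nVa Vval]] :=
    valuation_overring_omitting locring locRa a0 nlocaV.
  (* As a fractional ideal, [V] has a common denominator [d], a nonzero element of [(R : V)]. *)
  have [||[_ [d d0 dV]] _ _] := surj_v phi_surj V.
  + by split=> //; exact: (t_linked_localization Pprime).
  + by move=> VT; apply: nVa; rewrite VT.
  by apply: (conducive_of_valuation Vring Vval _ dV); rewrite tofrac_eq0.
- move=> P Pprime Pn0 nPmax; have [Pid _ _] := Pprime.
  have [Psub PR] := Pid.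
  split=> //; apply/seteqP; split=> x.
    move=> Px; rewrite -[x]mulr1; apply: mul_mem => //.
    exact: base_ring_sub_inverse (base_ring1 R).
  have [PinvR|PinvR] := pselect (inverse P = base_ring R).
    rewrite PinvR => -[n [p [r [Pp Rr ->]]]]; apply: ideal_sum => // i.
    by have [c _ <-] := Rr i; rewrite mulrC; case: Psub => _ _; exact.
  move=> [n [p [y [Pp Py ->]]]]; apply: ideal_sum => // i.
  (* Each product [p * y] lies in [R] and in [P R_P], hence in [P]. *)
  apply: localization_mul => //; last by rewrite mulrC; exact: Py.
  apply: inverse_sub_localization => // locR.
  exact/nPmax/localization_base_ring_maximal.
- move=> nloc M Mmax; have Mprime := maximal_prime Mmax.
  have [Mid M1 _] := Mmax.
  have MinvR : inverse M = base_ring R.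
    apply: contrapT => MinvR; apply: (MinvR).
    apply/seteqP; split; last exact: base_ring_sub_inverse.
    move=> z Mz; have [|s nMs sz] := inverse_sub_localization
        phi_surj Mprime (maximal_nonzero R_nf Mmax) MinvR _ Mz.
      by move=> locR; apply: nloc; exact: localization_base_ring_local locR.
    have [m [c [Mm E]]] := maximal_adjoin_1 Mmax nMs.
    (* Both terms are in [R]: [z] is in [M^-1] with [m] in [M], and [s] is a denominator of [z]. *)
    have -> : z = z * m + c%:F * (s%:F * z) by rewrite -[LHS]mulr1 E; ring.
    by apply: base_ringD; [exact: Mz|exact: base_ringM (base_ringF c) sz].
  (* [M_v = R^-1 = R] contains 1, while [M] does not. *)
  split=> // -[_ _ Mv]; apply: M1; rewrite Mv /v_closure MinvR.
  exact: base_ring_sub_inverse (ideal_base_ring R) _ (base_ring1 R).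
Qed.
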